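(* Let $G$ and $H$ be incidence hypergraphs and let $[G,H]_{L}$ and $\mathrm{cev}_{H}^{G}:G\blacksquare[G,H]_{L}\to H$ be as defined in the context. Then for every incidence hypergraph $K$ and every incidence hypergraph homomorphism $\phi:G\blacksquare K\to H$ there is a unique incidence hypergraph homomorphism $\hat{\phi}:K\to[G,H]_{L}$ such that $\mathrm{cev}_{H}^{G}\circ\left(G\blacksquare\hat{\phi}\right)=\phi$.
   Context: An incidence hypergraph $G$ consists of sets $\check V(G)$ (vertices), $\check E(G)$ (edges), $I(G)$ (incidences) and functions $\varsigma_G:I(G)\to\check V(G)$, $\omega_G:I(G)\to\check E(G)$. A homomorphism $\phi:G\to H$ is a triple of functions $\check V(\phi),\check E(\phi),I(\phi)$ with $\varsigma_H\circ I(\phi)=\check V(\phi)\circ\varsigma_G$ and $\omega_H\circ I(\phi)=\check E(\phi)\circ\omega_G$; composition is componentwise. $\mathfrak{R}$ is this category and $\mathfrak{R}(G,H)$ the set of homomorphisms. The incidence dual is $G^{\#}:=(\check E(G),\check V(G),I(G),\omega_G,\varsigma_G)$, i.e. $\check V(G^\#)=\check E(G)$, $\check E(G^\#)=\check V(G)$, $I(G^\#)=I(G)$, $\varsigma_{G^\#}=\omega_G$, $\omega_{G^\#}=\varsigma_G$; on morphisms $\phi^\#=(\check E(\phi),\check V(\phi),I(\phi))$. Laplacian product: $\check V(G\blacksquare H)=(\{1\}\times\check V(G)\times\check V(H))\cup(\{4\}\times\check E(G)\times\check E(H))$, $\check E(G\blacksquare H)=(\{2\}\times\check E(G)\times\check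 V(H))\cup(\{3\}\times\check V(G)\times\check E(H))$, $I(G\blacksquare H)=(\{1\}\times I(G)\times\check V(H))\cup(\{2\}\times I(G)\times\check E(H))\cup(\{3\}\times\check E(G)\times I(H))\cup(\{4\}\times\check V(G)\times I(H))$, with $\varsigma(1,x,y)=(1,\varsigma_G(x),y)$, $\varsigma(2,x,y)=(4,\omega_G(x),y)$, $\varsigma(3,x,y)=(4,x,\omega_H(y))$, $\varsigma(4,x,y)=(1,x,\varsigma_H(y))$, and $\omega(1,x,y)=(2,\omega_G(x),y)$, $\omega(2,x,y)=(3,\varsigma_G(x),y)$, $\omega(3,x,y)=(2,x,\varsigma_H(y))$, $\omega(4,x,y)=(3,x,\omega_H(y))$. For $\phi:G_1\to G_2$, $\psi:H_1\to H_2$, $\phi\blacksquare\psi$ acts by $(1,x,y)\mapsto(1,\check V\phi(x),\check V\psi(y))$, $(4,x,y)\mapsto(4,\check E\phi(x),\check E\psi(y))$ on vertices; $(2,x,y)\mapsto(2,\check E\phi(x),\check V\psi(y))$, $(3,x,y)\mapsto(3,\check V\phi(x),\check E\psi(y))$ on edges; and on incidences $(1,x,y)\mapsto(1,I\phi(x),\check V\psi(y))$, $(2,x,y)\mapsto(2,I\phi(x),\check E\psi(y))$, $(3,x,y)\mapsto(3,\check E\phi(x),I\psi(y))$, $(4,x,y)\mapsto(4,\check V\phi(x),I\psi(y))$. Special objects: $\check V^{\diamond}(\{1\})$ has one vertex $1$ and nothing else; $\check E^{\diamond}(\{1\})$ has one edge $1$ and nothing else; $I^{\diamond}(\{1\})$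 has one vertex $1$, one edge $1$, one incidence $1$ joining them. $Y(y):\check V^\diamond(\{1\})\to I^\diamond(\{1\})$ and $Y(z):\check E^\diamond(\{1\})\to I^\diamond(\{1\})$ are the homomorphisms sending the vertex (resp. edge) to the vertex (resp. edge). The isomorphism $\check\rho_G:G\blacksquare\check V^\diamond(\{1\})\to G$ is $(1,v,1)\mapsto v$, $(2,e,1)\mapsto e$, $(1,i,1)\mapsto i$; the isomorphism $\hat\rho_G:G\blacksquare\check E^\diamond(\{1\})\to G^\#$ is $(4,e,1)\mapsto e$ on vertices, $(3,v,1)\mapsto v$ on edges, $(2,i,1)\mapsto i$ on incidences. Laplacian exponential $[G,H]_L$: $\check V[G,H]_L=\mathfrak R(G,H)$, $\check E[G,H]_L=\mathfrak R(G^\#,H)$, $I[G,H]_L=\mathfrak R(G\blacksquare I^\diamond(\{1\}),H)$, $\varsigma(\psi)=\psi\circ(G\blacksquare Y(y))\circ\check\rho_G^{-1}$, $\omega(\psi)=\psi\circ(G\blacksquare Y(z))\circ\hat\rho_G^{-1}$. The evaluation $\mathrm{cev}_H^G:G\blacksquare[G,H]_L\to H$ is: $\check V(\mathrm{cev})(n,x,\phi)=\check V(\phi)(x)$, $\check E(\mathrm{cev})(n,x,\phi)=\check E(\phi)(x)$, $I(\mathrm{cev})(n,x,\psi)=I(\psi)(x)$ for $n=1,2$, $I(\psi)(3,x,1)$ for $n=3$, $I(\psi)(4,x,1)$ for $n=4$. *)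

(* Defs.v *)
From Stdlib Require Import FunctionalExtensionality ProofIrrelevance.

Set Implicit Arguments.
Unset Strict Implicit.

Record hypergraph : Type := Hypergraph {
  vert : Type;
  edge : Type;
  inc : Type;
  inc_vert : inc -> vert;  (* varsigma *)
  inc_edge : inc -> edge   (* omega *)
}.

Record hom (G H : hypergraph) : Type := Hom {
  homV : vert G -> vert H;
  homE : edge G -> edge H;
  homI : inc G -> inc H;
  hom_inc_vert : forall i, inc_vert (homI i) = homV (inc_vert i);
  hom_inc_edge : forall i, inc_edge (homI i) = homE (inc_edge i)
}.

(* Leibniz equality of homomorphisms is equality of the three underlying
   functions. *)
Lemma hom_ext (G H : hypergraph) (f g : hom G H) :
  (forall x, homV f x = homV g x) ->
  (forall e, homE f e = homE g e) ->
  (forall i, homI f i = homI g i) -> f = g.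
Proof.
destruct f as [fV fE fI fv fe], g as [gV gE gI gv ge]; simpl.
intros eV eE eI.
apply functional_extensionality in eV.
apply functional_extensionality in eE.
apply functional_extensionality in eI.
subst gV gE gI.
f_equal; apply proof_irrelevance.
Qed.

Definition hom_id (G : hypergraph) : hom G G :=
  {| homV := fun x => x; homE := fun e => e; homI := fun i => i;
     hom_inc_vert := fun i => eq_refl; hom_inc_edge := fun i => eq_refl |}.

Definition hom_comp (G H K : hypergraph) (g : hom H K) (f : hom G H) : hom G K.
Proof.
refine {| homV := fun x => homV g (homV f x);
          homE := fun e => homE g (homE f e);
          homI := fun i => homI g (homI f i) |}.
- abstract (intro i; rewrite !hom_inc_vert; reflexivity).
- abstract (intro i; rewrite !hom_inc_edge; reflexivity).
Defined.

Definition dual (G : hypergraph) : hypergraph :=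
  {| vert := edge G; edge := vert G; inc := inc G;
     inc_vert := @inc_edge G; inc_edge := @inc_vert G |}.

(* The Laplacian product. The numeral in a constructor name is the tag of the
   corresponding summand of the disjoint union. *)
Inductive lap_vert (G H : hypergraph) : Type :=
| LV1 : vert G -> vert H -> lap_vert G H
| LV4 : edge G -> edge H -> lap_vert G H.

Inductive lap_edge (G H : hypergraph) : Type :=
| LE2 : edge G -> vert H -> lap_edge G H
| LE3 : vert G -> edge H -> lap_edge G H.

Inductive lap_inc (G H : hypergraph) : Type :=
| LI1 : inc G -> vert H -> lap_inc G H
| LI2 : inc G -> edge H -> lap_inc G H
| LI3 : edge G -> inc H -> lap_inc G H
| LI4 : vert G -> inc H -> lap_inc G H.

Arguments LV1 {G H} _ _.
Arguments LV4 {G H} _ _.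
Arguments LE2 {G H} _ _.
Arguments LE3 {G H} _ _.
Arguments LI1 {G H} _ _.
Arguments LI2 {G H} _ _.
Arguments LI3 {G H} _ _.
Arguments LI4 {G H} _ _.

Definition lap (G H : hypergraph) : hypergraph :=
  {| vert := lap_vert G H;
     edge := lap_edge G H;
     inc := lap_inc G H;
     inc_vert := fun i => match i with
       | LI1 x y => LV1 (inc_vert x) y
       | LI2 x y => LV4 (inc_edge x) y
       | LI3 x y => LV4 x (inc_edge y)
       | LI4 x y => LV1 x (inc_vert y)
       end;
     inc_edge := fun i => match i with
       | LI1 x y => LE2 (inc_edge x) y
       | LI2 x y => LE3 (inc_vert x) y
       | LI3 x y => LE2 x (inc_vert y)
       | LI4 x y => LE3 x (inc_edge y)
       end |}.

Definition lap_map (G1 G2 H1 H2 : hypergraph) (f : hom G1 G2) (g : hom H1 H2) :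
  hom (lap G1 H1) (lap G2 H2).
Proof.
refine (@Hom (lap G1 H1) (lap G2 H2)
  (fun v => match v with
    | LV1 x y => LV1 (homV f x) (homV g y)
    | LV4 x y => LV4 (homE f x) (homE g y)
    end)
  (fun e => match e with
    | LE2 x y => LE2 (homE f x) (homV g y)
    | LE3 x y => LE3 (homV f x) (homE g y)
    end)
  (fun i => match i with
    | LI1 x y => LI1 (homI f x) (homV g y)
    | LI2 x y => LI2 (homI f x) (homE g y)
    | LI3 x y => LI3 (homE f x) (homI g y)
    | LI4 x y => LI4 (homV f x) (homI g y)
    end) _ _).
- abstract (intros []; simpl; rewrite ?hom_inc_vert, ?hom_inc_edge; reflexivity).
- abstract (intros []; simpl; rewrite ?hom_inc_vert, ?hom_inc_edge; reflexivity).
Defined.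

(* V^diamond({1}), E^diamond({1}) and I^diamond({1}), with [unit] for {1}. *)
Definition vertex_obj : hypergraph :=
  {| vert := unit; edge := Empty_set; inc := Empty_set;
     inc_vert := fun i => match i with end;
     inc_edge := fun i => match i with end |}.

Definition edge_obj : hypergraph :=
  {| vert := Empty_set; edge := unit; inc := Empty_set;
     inc_vert := fun i => match i with end;
     inc_edge := fun i => match i with end |}.

Definition inc_obj : hypergraph :=
  {| vert := unit; edge := unit; inc := unit;
     inc_vert := fun _ => tt; inc_edge := fun _ => tt |}.

Definition Yy : hom vertex_obj inc_obj :=
  @Hom vertex_obj inc_obj
    (fun _ => tt) (fun e => match e with end) (fun i => match i with end)
    (fun i => match i with end) (fun i => match i with end).

Definition Yz : hom edge_obj inc_obj :=
  @Hom edge_obj inc_obj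
    (fun v => match v with end) (fun _ => tt) (fun i => match i with end)
    (fun i => match i with end) (fun i => match i with end).

Definition rho_vert (G : hypergraph) : hom (lap G vertex_obj) G.
Proof.
refine (@Hom (lap G vertex_obj) G
  (fun v => match v with LV1 x _ => x | LV4 _ y => match y with end end)
  (fun e => match e with LE2 x _ => x | LE3 _ y => match y with end end)
  (fun i => match i with
    | LI1 x _ => x
    | LI2 _ y => match y with end
    | LI3 _ y => match y with end
    | LI4 _ y => match y with end
    end) _ _).
- abstract (intros [x y|x []|x []|x []]; reflexivity).
- abstract (intros [x y|x []|x []|x []]; reflexivity).
Defined.

Definition rho_vert_inv (G : hypergraph) : hom G (lap G vertex_obj) :=
  @Hom G (lap G vertex_obj)
    (fun v => @LV1 G vertex_obj v tt) (fun e => @LE2 G vertex_obj e tt) (fun i => @LI1 G vertex_obj i tt)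
    (fun i => eq_refl) (fun i => eq_refl).

Lemma rho_vertK (G : hypergraph) :
  hom_comp (rho_vert_inv G) (rho_vert G) = hom_id (lap G vertex_obj).
Proof.
apply hom_ext; simpl.
- intros [x []|x []]; reflexivity.
- intros [x []|x []]; reflexivity.
- intros [x []|x []|x []|x []]; reflexivity.
Qed.

Lemma rho_vert_invK (G : hypergraph) :
  hom_comp (rho_vert G) (rho_vert_inv G) = hom_id G.
Proof. apply hom_ext; reflexivity. Qed.

Definition rho_edge (G : hypergraph) : hom (lap G edge_obj) (dual G).
Proof.
refine (@Hom (lap G edge_obj) (dual G)
  (fun v => match v with LV1 _ y => match y with end | LV4 x _ => x end)
  (fun e => match e with LE2 _ y => match y with end | LE3 x _ => x end)
  (fun i => match i with
    | LI1 _ y => match y with end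
    | LI2 x _ => x
    | LI3 _ y => match y with end
    | LI4 _ y => match y with end
    end) _ _).
- abstract (intros [x []|x y|x []|x []]; reflexivity).
- abstract (intros [x []|x y|x []|x []]; reflexivity).
Defined.

Definition rho_edge_inv (G : hypergraph) : hom (dual G) (lap G edge_obj) :=
  @Hom (dual G) (lap G edge_obj)
    (fun e => @LV4 G edge_obj e tt) (fun v => @LE3 G edge_obj v tt) (fun i => @LI2 G edge_obj i tt)
    (fun i => eq_refl) (fun i => eq_refl).

Lemma rho_edgeK (G : hypergraph) :
  hom_comp (rho_edge_inv G) (rho_edge G) = hom_id (lap G edge_obj).
Proof.
apply hom_ext; simpl.
- intros [x []|x []]; reflexivity.
- intros [x []|x []]; reflexivity.
- intros [x []|x []|x []|x []]; reflexivity.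
Qed.

Lemma rho_edge_invK (G : hypergraph) :
  hom_comp (rho_edge G) (rho_edge_inv G) = hom_id (dual G).
Proof. apply hom_ext; reflexivity. Qed.

Definition lap_exp (G H : hypergraph) : hypergraph :=
  {| vert := hom G H;
     edge := hom (dual G) H;
     inc := hom (lap G inc_obj) H;
     inc_vert := fun f =>
       hom_comp f (hom_comp (lap_map (hom_id G) Yy) (rho_vert_inv G));
     inc_edge := fun f =>
       hom_comp f (hom_comp (lap_map (hom_id G) Yz) (rho_edge_inv G)) |}.

(* In the clauses for LI3 and LI4, [f] is an incidence of [lap_exp G H], i.e. a
   homomorphism on [lap G inc_obj], evaluated at (3, x, 1) and (4, x, 1). *)
Definition cev (G H : hypergraph) : hom (lap G (lap_exp G H)) H.
Proof.
refine (@Hom (lap G (lap_exp G H)) H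
  (fun v => match v with
    | LV1 x f => homV (f : hom G H) x
    | LV4 x f => homV (f : hom (dual G) H) x
    end)
  (fun e => match e with
    | LE2 x f => homE (f : hom G H) x
    | LE3 x f => homE (f : hom (dual G) H) x
    end)
  (fun i => match i with
    | LI1 x f => homI (f : hom G H) x
    | LI2 x f => homI (f : hom (dual G) H) x
    | LI3 x f => homI (f : hom (lap G inc_obj) H) (@LI3 G inc_obj x tt)
    | LI4 x f => homI (f : hom (lap G inc_obj) H) (@LI4 G inc_obj x tt)
    end) _ _).
- abstract (intros [x f|x f|x f|x f]; exact (hom_inc_vert f _)).
- abstract (intros [x f|x f|x f|x f]; exact (hom_inc_edge f _)).
Defined.

(* Main.v *)
(** By the Yoneda lemma a vertex, edge or incidence of [K] is a homomorphism
    into [K] from the vertex, edge or incidence object, so that tensoring with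
    [G] and composing with [phi] gives the transpose of [phi].  For uniqueness,
    the evaluation recovers a vertex or an edge of the exponential completely,
    and an incidence up to its values outside the summands 3 and 4, which are
    those of its end vertex and end edge. *)

Require Import Defs.

Definition vert_point (K : hypergraph) (k : vert K) : hom vertex_obj K :=
  @Hom vertex_obj K
    (fun _ => k) (fun e => match e with end) (fun i => match i with end)
    (fun i => match i with end) (fun i => match i with end).

Definition edge_point (K : hypergraph) (k : edge K) : hom edge_obj K :=
  @Hom edge_obj K
    (fun v => match v with end) (fun _ => k) (fun i => match i with end)
    (fun i => match i with end) (fun i => match i with end).

Definition inc_point (K : hypergraph) (k : inc K) : hom inc_obj K :=
  @Hom inc_obj K (fun _ => inc_vert k) (fun _ => inc_edge k) (fun _ => k)
    (fun _ => eq_refl) (fun _ => eq_refl).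

Definition transpose (G H K : hypergraph) (phi : hom (lap G K) H) :
  hom K (lap_exp G H).
Proof.
refine (@Hom K (lap_exp G H)
  (fun k => hom_comp phi
     (hom_comp (lap_map (hom_id G) (vert_point K k)) (rho_vert_inv G)))
  (fun k => hom_comp phi
     (hom_comp (lap_map (hom_id G) (edge_point K k)) (rho_edge_inv G)))
  (fun k => hom_comp phi (lap_map (hom_id G) (inc_point K k))) _ _);
  (* Restricting [inc_point K k] along [Yy] or [Yz] gives the point of its end vertex or end edge,
     so both sides compute to the same functions. *)
  abstract (intro k; apply hom_ext; reflexivity).
Defined.

Lemma cev_transpose (G H K : hypergraph) (phi : hom (lap G K) H) :
  hom_comp (cev G H) (lap_map (hom_id G) (transpose G H K phi)) = phi.
Proof. apply hom_ext; intros []; reflexivity. Qed.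

(** All vertices and edges of [lap G inc_obj], and its incidences in summands 1 and 2, come from
    [lap G vertex_obj] or [lap G edge_obj], so the two ends fix the values there. *)
Lemma lap_exp_inc_ext (G H : hypergraph) (f g : inc (lap_exp G H)) :
  inc_vert f = inc_vert g -> inc_edge f = inc_edge g ->
  (forall x, homI f (@LI3 G inc_obj x tt) = homI g (@LI3 G inc_obj x tt)) ->
  (forall x, homI f (@LI4 G inc_obj x tt) = homI g (@LI4 G inc_obj x tt)) ->
  f = g.
Proof.
intros eqv eqe eq3 eq4; apply hom_ext.
- intros [x []|x []].
  + exact (f_equal (fun h : hom G H => homV h x) eqv).
  + exact (f_equal (fun h : hom (dual G) H => homV h x) eqe).
- intros [x []|x []].
  + exact (f_equal (fun h : hom G H => homE h x) eqv).
  + exact (f_equal (fun h : hom (dual G) H => homE h x) eqe).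
- intros [x []|x []|x []|x []].
  + exact (f_equal (fun h : hom G H => homI h x) eqv).
  + exact (f_equal (fun h : hom (dual G) H => homI h x) eqe).
  + apply eq3.
  + apply eq4.
Qed.

Lemma cev_lap_map_inj (G H K : hypergraph) (f g : hom K (lap_exp G H)) :
  hom_comp (cev G H) (lap_map (hom_id G) f) =
  hom_comp (cev G H) (lap_map (hom_id G) g) -> f = g.
Proof.
intro eqfg.
pose proof (fun v => f_equal (fun h => homV h v) eqfg) as eqV.
pose proof (fun e => f_equal (fun h => homE h e) eqfg) as eqE.
pose proof (fun i => f_equal (fun h => homI h i) eqfg) as eqI.
assert (fgV : forall k, homV f k = homV g k).
{ intro k; apply hom_ext; intro x.
  - exact (eqV (LV1 x k)).
  - exact (eqE (LE2 x k)).
  - exact (eqI (LI1 x k)). }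
assert (fgE : forall k, homE f k = homE g k).
(* Vertices of [dual G] are edges of [G] and conversely, hence the tags 4, 3 and 2. *)
{ intro k; apply hom_ext; intro x.
  - exact (eqV (LV4 x k)).
  - exact (eqE (LE3 x k)).
  - exact (eqI (@LI2 G K x k)). }
apply hom_ext; [exact fgV | exact fgE |].
intro k; apply lap_exp_inc_ext.
(* The ends of [homI f k] are the images under [f] of the ends of [k], where agreement is already
   known. *)
- rewrite !hom_inc_vert; apply fgV.
- rewrite !hom_inc_edge; apply fgE.
- intro x; exact (eqI (LI3 x k)).
- intro x; exact (eqI (LI4 x k)).
Qed.

Theorem mainTheorem1 (G H K : hypergraph) (phi : hom (lap G K) H) :
  exists! phihat : hom K (lap_exp G H),
    hom_comp (cev G H) (lap_map (hom_id G) phihat) = phi.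
Proof.
exists (transpose G H K phi); split.
- apply cev_transpose.
- intros psi eqpsi; apply cev_lap_map_inj.
  rewrite eqpsi; apply cev_transpose.
Qed.
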